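(* Let $j \in \{1,\dots,n\}$ and $E \subset \mathbb{R}^n$. Then all points in the constraint MARO-efficiency objective space image $im_j^f(E)$ are weakly nondominated; that is, for every $p \in im_j^f(E)$ there is no $q \in im_j^f(E)$ with $q_i < p_i$ for all $i \in \{1,\dots,n\}$.
   Context: Setting (multicriteria adjustable robust optimization): $\mathcal{X} \subset \mathbb{R}^{n_x}$ and $\mathcal{U} \subset \mathbb{R}^{n_u}$ are compact sets; for each $x \in \mathcal{X}$, $u \in \mathcal{U}$, $\mathcal{Y}(x,u) \subset \mathbb{R}^{n_y}$ is a compact set; $f = (f_1,\dots,f_n)^T$ with each $f_i(x,u,y)$ a continuous real-valued function. Here $\max$ and $\min$ denote optimal values (in the extended reals); minimization over an empty set has value $+\infty$ and maximization over an empty set has value $-\infty$. For $\varepsilon \in \mathbb{R}^n$, $j \in \{1,\dots,n\}$ and $x \in \mathcal{X}$ let $$f_{\varepsilon,j}(x) := \max_{u \in \mathcal{U}} \ \min \{ f_j(x,u,y) : y \in \mathcal{Y}(x,u),\ f_i(x,u,y) \le \varepsilon_i \ \forall i \ne j \},$$ $$im_j^f(\varepsilon) := \left(\varepsilon_1,\dots,\varepsilon_{j-1},\ \min_{x \in \mathcal{X}} f_{\varepsilon,j}(x),\ \varepsilon_{j+1},\dots,\varepsilon_n\right)^T,$$ and $im_j^f(E) := \{ im_j^f(\varepsilon) : \varepsilon \in E\}$ (the $j$-th coordinate may take extended real values). *)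

(* Defs.v *)
From HB Require Import structures.
From mathcomp Require Import all_boot all_order all_algebra.
From mathcomp Require Import all_classical all_reals all_analysis.

Set Implicit Arguments.
Unset Strict Implicit.
Unset Printing Implicit Defensive.

Import Order.TTheory GRing.Theory Num.Theory.
Import numFieldNormedType.Exports.

Local Open Scope classical_set_scope.
Local Open Scope ring_scope.

Section MARO.

Variables (R : realType) (n nx nu ny : nat).
Variables (X : set 'rV[R]_nx) (U : set 'rV[R]_nu).
Variable Y : 'rV[R]_nx -> 'rV[R]_nu -> set 'rV[R]_ny.
Variable f : 'I_n -> 'rV[R]_nx -> 'rV[R]_nu -> 'rV[R]_ny -> R.

(* [f] and [Y] are total, but only their values on this set are meaningful:
   compactness of [Y x u] and continuity of [f i] are only ever required for
   [x] in [X], [u] in [U] and [y] in [Y x u]. *)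
Definition admissible : set ('rV[R]_nx * 'rV[R]_nu * 'rV[R]_ny) :=
  [set p | [/\ X p.1.1, U p.1.2 & Y p.1.1 p.1.2 p.2]].

Definition feasible (eps : 'rV[R]_n) (j : 'I_n) x u : set 'rV[R]_ny :=
  [set y | Y x u y /\ forall i, i != j -> f i x u y <= eps 0 i].

(* Optimal values are taken in the extended reals, so [ereal_inf set0 = +oo]
   and [ereal_sup set0 = -oo] give the values of problems over an empty set. *)
Definition f_eps (eps : 'rV[R]_n) (j : 'I_n) x : \bar R :=
  ereal_sup [set ereal_inf [set (f j x u y)%:E | y in feasible eps j x u]
            | u in U].

Definition im_f (j : 'I_n) (eps : 'rV[R]_n) : 'rV[\bar R]_n :=
  \row_i (if i == j then ereal_inf [set f_eps eps j x | x in X]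
          else (eps 0 i)%:E).

End MARO.

Definition weakly_nondominated (R : realType) (n : nat)
    (S : set 'rV[\bar R]_n) (p : 'rV[\bar R]_n) : Prop :=
  ~ exists2 q, S q & forall i, (q ord0 i < p ord0 i)%E.

(* Main.v *)
Require Import Defs.
From HB Require Import structures.
From mathcomp Require Import all_boot all_order all_algebra.
From mathcomp Require Import all_classical all_reals all_analysis.

(** Only the [j]-th coordinate of an image point depends on the optimization
    problem; the others are the bounds [eps] themselves.  A point that is
    strictly smaller in every coordinate therefore comes from tighter bounds,
    and tighter bounds shrink every inner feasible set.  This raises every inner
    minimum, hence the worst case over [U] and finally the minimum over [X]
    ([ereal_inf_f_eps_anti]), so the [j]-th coordinate cannot be strictly smaller
    as well.  Monotonicity of infima and suprema in the extended reals covers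
    empty feasible sets too. *)

Set Implicit Arguments.
Unset Strict Implicit.
Unset Printing Implicit Defensive.

Import Order.TTheory GRing.Theory Num.Theory.
Import numFieldNormedType.Exports.

Local Open Scope classical_set_scope.
Local Open Scope ring_scope.

Section Monotonicity.

Variables (R : realType) (n nx nu ny : nat).
Variables (X : set 'rV[R]_nx) (U : set 'rV[R]_nu).
Variable Y : 'rV[R]_nx -> 'rV[R]_nu -> set 'rV[R]_ny.
Variable f : 'I_n -> 'rV[R]_nx -> 'rV[R]_nu -> 'rV[R]_ny -> R.
Variables (j : 'I_n) (eps eps' : 'rV[R]_n).
Hypothesis le_eps : forall i, i != j -> eps 0 i <= eps' 0 i.

Lemma feasible_sub x u : feasible Y f eps j x u `<=` feasible Y f eps' j x u.
Proof.
move=> y [Yy fy]; split=> // i ij; exact: le_trans (fy i ij) (le_eps ij).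
Qed.

Lemma f_eps_anti x : (f_eps U Y f eps' j x <= f_eps U Y f eps j x)%E.
Proof.
apply: ge_ereal_sup => _ [u Uu <-].
apply: (@le_trans _ _
  (ereal_inf [set (f j x u y)%:E | y in feasible Y f eps j x u])).
  by apply: ereal_inf_le_tmp; apply: image_subset; exact: feasible_sub.
by apply: ereal_sup_ubound; exists u.
Qed.

Lemma ereal_inf_f_eps_anti :
  (ereal_inf [set f_eps U Y f eps' j x | x in X] <=
   ereal_inf [set f_eps U Y f eps j x | x in X])%E.
Proof.
apply: le_ereal_inf_tmp => _ [x Xx <-].
by apply: le_trans (f_eps_anti x); apply: ereal_inf_lbound; exists x.
Qed.

End Monotonicity.

Theorem lemma20 (R : realType) (n nx nu ny : nat)
    (X : set 'rV[R]_nx) (U : set 'rV[R]_nu)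
    (Y : 'rV[R]_nx -> 'rV[R]_nu -> set 'rV[R]_ny)
    (f : 'I_n -> 'rV[R]_nx -> 'rV[R]_nu -> 'rV[R]_ny -> R)
    (cX : compact X) (cU : compact U)
    (cY : forall x u, X x -> U u -> compact (Y x u))
    (cf : forall i, {within admissible X U Y,
                     continuous (fun p => f i p.1.1 p.1.2 p.2)})
    (j : 'I_n) (E : set 'rV[R]_n) :
  forall p, (im_f X U Y f j @` E) p ->
    weakly_nondominated (im_f X U Y f j @` E) p.
Proof.
move=> _ [eps _ <-] [_ [eps' _ <-]] lt_im.
have le_eps i : i != j -> eps' 0 i <= eps 0 i.
  by move=> /negPf ij; have := lt_im i; rewrite !mxE ij lte_fin => /ltW.
by have := lt_im j; rewrite !mxE eqxx ltNge ereal_inf_f_eps_anti.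
Qed.
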